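(* $\mathcal O^\omega$ gives the least basic topology strictly greater than $\mathrm{id}$; that is, $\mathrm{lo}_{\mathcal O^\omega}>\mathrm{id}$, and for every $\mathcal A\in\mathcal P(\mathcal P(\mathbb N))$ with $\mathrm{lo}_{\mathcal A}>\mathrm{id}$ one has $\mathrm{lo}_{\mathcal O^\omega}\le\mathrm{lo}_{\mathcal A}$.
   Context: Write $e(n)$ for the (possibly undefined) value at $n$ of the $e$-th partial recursive function, and $\langle\cdot,\cdot\rangle$ for a fixed recursive bijective pairing on $\mathbb{N}$. $\mathcal P(X)$ is the power set. For $A,B\subseteq\mathbb{N}$ put $A\Rightarrow B=\{e : \text{for all } a\in A,\ e(a)\text{ is defined and } e(a)\in B\}$ and $A\wedge B=\{\langle a,b\rangle : a\in A, b\in B\}$. For $h,k:\mathcal P(\mathbb N)\to\mathcal P(\mathbb N)$ write $h\le k$ if $\bigcap_{p\subseteq\mathbb N}(h(p)\Rightarrow k(p))\ne\emptyset$. A local operator (= topology, Lawvere–Tierney topology) on the effective topos $\mathbf{Eff}$ is represented by a function $j:\mathcal P(\mathbb N)\to\mathcal P(\mathbb N)$ such that $\bigcap_p(p\Rightarrow j(p))$, $\bigcap_{p,q}(j(p\Rightarrow q)\Rightarrow(j(p)\Rightarrow j(q)))$ and $\bigcap_p(j(j(p))\Rightarrow j(p))$ are non-empty; $j,k$ represent the same local operator iff $j\le k$ and $k\le j$, and local operators are ordered by $\le$ ($j<k$ means $j\le k$ and not $k\le j$). The least local operator is $\mathrm{id}$, represented by $p\mapsto p$. For $\theta:\mathbb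 N\to\mathcal P(\mathcal P(\mathbb N))$ put $\mathrm{mo}_\theta(p)=\{\langle n,e\rangle : \exists A\in\theta(n),\ e\in(A\Rightarrow p)\}$, and let $\mathrm{lo}_\theta$ be the least local operator $j$ with $\mathrm{mo}_\theta\le j$; it is represented by $\mathrm{lo}_\theta(p)=\bigcap_{q\subseteq\mathbb N}\big(((\mathrm{mo}_\theta(q)\Rightarrow q)\wedge(p\Rightarrow q))\Rightarrow q\big)$. A collection $\mathcal A\in\mathcal P(\mathcal P(\mathbb N))$ is identified with the constant function $\mathbb N\to\mathcal P(\mathcal P(\mathbb N))$ with value $\mathcal A$; this defines $\mathrm{lo}_{\mathcal A}$. A local operator is basic if it equals $\mathrm{lo}_{\mathcal A}$ for some collection $\mathcal A\in\mathcal P(\mathcal P(\mathbb N))$. $\mathcal O^\omega=\{\mathbb N\setminus\{n\} : n\in\mathbb N\}$. *)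

(* Defs.v *)
From Stdlib Require Cantor.
From mathcomp Require Import all_boot classical_sets.

Set Implicit Arguments.
Unset Strict Implicit.
Unset Printing Implicit Defensive.

Local Open Scope classical_set_scope.

(* Cantor pairing, the recursive bijection between nat * nat and nat whose
   inverse is Cantor.of_nat. *)
Definition npair (a b : nat) : nat := Cantor.to_nat (a, b).

(* Partial recursive functions are presented as unary functions, with tuples of
   arguments coded by npair: the basic functions are zero, successor and the two
   unpairings, closed under pairing, composition, primitive recursion and
   unbounded minimization. *)
Inductive code : Type :=
| Zero | Succ | Fst | Snd
| Pair of code & code
| Comp of code & code
| Prec of code & code
| Mu of code.

Fixpoint prec_graph (F G : nat -> nat -> Prop) (a n y : nat) : Prop :=
  if n is m.+1 then
    exists z, prec_graph F G a m z /\ G (npair a (npair m z)) y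
  else F a y.

(* eval c x y: the partial function with code c is defined at x, with value y. *)
Fixpoint eval (c : code) (x y : nat) : Prop :=
  match c with
  | Zero => y = 0
  | Succ => y = x.+1
  | Fst => y = (Cantor.of_nat x).1
  | Snd => y = (Cantor.of_nat x).2
  | Pair f g => exists a b, [/\ eval f x a, eval g x b & y = npair a b]
  | Comp f g => exists z, eval g x z /\ eval f z y
  | Prec f g => let: (a, n) := Cantor.of_nat x in
                prec_graph (eval f) (eval g) a n y
  | Mu f => eval f (npair x y) 0 /\
            forall m, m < y -> exists k, eval f (npair x m) k.+1
  end.

Fixpoint encode (c : code) : nat :=
  match c with
  | Zero => npair 0 0
  | Succ => npair 1 0
  | Fst => npair 2 0
  | Snd => npair 3 0
  | Pair f g => npair 4 (npair (encode f) (encode g))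
  | Comp f g => npair 5 (npair (encode f) (encode g))
  | Prec f g => npair 6 (npair (encode f) (encode g))
  | Mu f => npair 7 (encode f)
  end.

(* phi e x y: the e-th partial recursive function is defined at x, with value y.
   An index e that is not of the form encode c denotes the nowhere defined
   function. *)
Definition phi (e x y : nat) : Prop := exists c, encode c = e /\ eval c x y.

Lemma npair_inj a b a' b' : npair a b = npair a' b' -> a = a' /\ b = b'.
Proof. by move/Cantor.to_nat_inj => [-> ->]. Qed.

Lemma encode_inj : injective encode.
Proof.
elim=> [||||f IHf g IHg|f IHf g IHg|f IHf g IHg|f IHf] [||||f' g'|f' g'|f' g'|f'] //=
  /npair_inj[] // _.
- by move=> /npair_inj[/IHf-> /IHg->].
- by move=> /npair_inj[/IHf-> /IHg->].
- by move=> /npair_inj[/IHf-> /IHg->].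
- by move=> /IHf->.
Qed.

Lemma eval_functional c x y y' : eval c x y -> eval c x y' -> y = y'.
Proof.
elim: c x y y' => [||||f IHf g IHg|f IHf g IHg|f IHf g IHg|f IHf] x y y' /=.
1-4: by move=> -> ->.
- by move=> [a [b [fa gb ->]]] [a' [b' [/(IHf _ _ _ fa)<- /(IHg _ _ _ gb)<- ->]]].
- by move=> [z [gz fy]] [z' [/(IHg _ _ _ gz)<- /(IHf _ _ _ fy)]].
- case: (Cantor.of_nat x) => a n; elim: n y y' => [|n IHn] y y' /=.
    exact: IHf.
  by move=> [z [rz gy]] [z' [/(IHn _ _ rz)<- /(IHg _ _ _ gy)]].
- move=> [f0 fS] [f0' fS']; case: (ltngtP y y') => // lt.
    by have [k /(IHf _ _ _ f0)] := fS' _ lt.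
  by have [k /(IHf _ _ _ f0')] := fS _ lt.
Qed.

Lemma phi_functional e x y y' : phi e x y -> phi e x y' -> y = y'.
Proof.
by move=> [c [<- cy]] [c' [/encode_inj-> cy']]; apply: eval_functional cy cy'.
Qed.

Declare Scope realizability_scope.
Delimit Scope realizability_scope with rz.
Open Scope realizability_scope.

Definition rimp (A B : set nat) : set nat :=
  [set e | forall a, A a -> exists b, phi e a b /\ B b].

Definition rand (A B : set nat) : set nat :=
  [set x | exists a b, [/\ A a, B b & x = npair a b]].

Notation "A ⇒ B" := (rimp A B)
  (at level 60, right associativity) : realizability_scope.
Notation "A ⩕ B" := (rand A B)
  (at level 55, right associativity) : realizability_scope.

Definition rle (h k : set nat -> set nat) : Prop :=
  \bigcap_(p in [set: set nat]) (h p ⇒ k p) !=set0.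

Definition rlt (h k : set nat -> set nat) : Prop := rle h k /\ ~ rle k h.

Notation "h ≼ k" := (rle h k) (at level 70) : realizability_scope.
Notation "h ≺ k" := (rlt h k) (at level 70) : realizability_scope.

Definition mo (theta : nat -> set (set nat)) (p : set nat) : set nat :=
  [set x | exists n e, x = npair n e /\ exists2 A, theta n A & (A ⇒ p) e].

(* The second-order representative of the least local operator above mo theta. *)
Definition lo (theta : nat -> set (set nat)) (p : set nat) : set nat :=
  \bigcap_(q in [set: set nat]) (((mo theta q ⇒ q) ⩕ (p ⇒ q)) ⇒ q).

Definition lo_coll (A : set (set nat)) : set nat -> set nat := lo (fun=> A).

Definition Oomega : set (set nat) := [set ~` [set n] | n in [set: nat]].

(* Main.v *)
From Stdlib Require Cantor.
Require Import Defs.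
From mathcomp Require Import all_boot boolp classical_sets.

(** If some number belongs to every member of [A], evaluation at that number
realizes [lo_A <= id].  So [lo_A > id] forces every [n] to be avoided by some
member of [A], which is then contained in the complement of [{n}]; hence
[mo_O q] is contained in [mo_A q] for every [q], [O] being [Oomega], and
[lo_O p] in [lo_A p].

Conversely the numbers [<0, t>], with [t] realizing [p => q] for some
co-singleton [p], lie in [mo_O q]; so [<s, t> |-> s <0, t>] has an index lying
in [lo_O (N \ {n})] for all [n] at once.  A realizer of [lo_O <= id] would map
it to a number different from every [n].

These realizers need a universal partial recursive function, obtained by
running a stack machine whose step function is primitive recursive. *)

Set Implicit Arguments.
Unset Strict Implicit.
Unset Printing Implicit Defensive.

Local Open Scope classical_set_scope.

Definition pfst (x : nat) : nat := (Cantor.of_nat x).1.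
Definition psnd (x : nat) : nat := (Cantor.of_nat x).2.

Lemma pfstE a b : pfst (npair a b) = a.
Proof. by rewrite /pfst /npair Cantor.cancel_of_to. Qed.

Lemma psndE a b : psnd (npair a b) = b.
Proof. by rewrite /psnd /npair Cantor.cancel_of_to. Qed.

Lemma npairK x : npair (pfst x) (psnd x) = x.
Proof.
by rewrite /npair /pfst /psnd -surjective_pairing Cantor.cancel_to_of.
Qed.

Arguments pfst : simpl never.
Arguments psnd : simpl never.

Definition pairE := (pfstE, psndE).

(** * Total recursive functions *)

Definition computes (c : code) (f : nat -> nat) : Prop :=
  forall x, eval c x (f x).

Definition recursive (f : nat -> nat) : Prop := exists c, computes c f.

Lemma recursive_ext f g : f =1 g -> recursive f -> recursive g.
Proof. by move=> fg [c cf]; exists c => x; rewrite -fg. Qed.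

Lemma recursive_succ : recursive succn.
Proof. by exists Succ. Qed.

Lemma recursive_fst : recursive pfst.
Proof. by exists Fst. Qed.

Lemma recursive_snd : recursive psnd.
Proof. by exists Snd. Qed.

Lemma recursive_pair f g : recursive f -> recursive g ->
  recursive (fun x => npair (f x) (g x)).
Proof. by move=> [c cf] [d dg]; exists (Pair c d) => x; exists (f x), (g x). Qed.

Lemma recursive_comp f g : recursive f -> recursive g ->
  recursive (fun x => f (g x)).
Proof. by move=> [c cf] [d dg]; exists (Comp c d) => x; exists (g x). Qed.

Definition id_code : code := Pair Fst Snd.

Lemma id_codeE : computes id_code id.
Proof. by move=> x; exists (pfst x), (psnd x); split=> //=; rewrite npairK. Qed.

Lemma recursive_id : recursive id.
Proof. by exists id_code; exact: id_codeE. Qed.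

Fixpoint const_code (n : nat) : code :=
  if n is m.+1 then Comp Succ (const_code m) else Zero.

Lemma const_codeE n : computes (const_code n) (fun=> n).
Proof. by elim: n => [//|n IHn] x; exists n. Qed.

Lemma recursive_const n : recursive (fun=> n).
Proof. by exists (const_code n); exact: const_codeE. Qed.

Lemma recursive_nat_rec f g : recursive f -> recursive g ->
  recursive (fun x =>
    nat_rect (fun=> nat) (f (pfst x))
      (fun m z => g (npair (pfst x) (npair m z))) (psnd x)).
Proof.
move=> [c cf] [d dg]; exists (Prec c d) => x /=.
rewrite /pfst /psnd; case: (Cantor.of_nat x) => a n /=.
by elim: n => [|n IHn] /=; [exact: cf | eexists; split; [exact: IHn | exact: dg]].
Qed.

Lemma recursive_iter f : recursive f ->
  recursive (fun x => iter (psnd x) f (pfst x)).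
Proof.
move=> rf.
have rg : recursive (fun x => f (psnd (psnd x))).
  apply: recursive_comp rf _.
  by apply: recursive_comp recursive_snd _; exact: recursive_snd.
apply: recursive_ext (recursive_nat_rec recursive_id rg) => x /=.
by elim: (psnd x) => //= n ->; rewrite !pairE.
Qed.

Lemma recursive_pred : recursive predn.
Proof.
(* The recursion step returns its counter [m] from [npair a (npair m z)], so the last stage yields
   [x.-1]; the base value 0 covers [x = 0]. *)
have rg : recursive (fun x => pfst (psnd x)).
  by apply: recursive_comp recursive_fst _; exact: recursive_snd.
have rp := recursive_pair (recursive_const 0) recursive_id.
apply: recursive_ext (recursive_comp (recursive_nat_rec recursive_id rg) rp) => x.
by rewrite /= !pairE; case: x => //= x; rewrite !pairE.
Qed.

Lemma recursive_if0 f g h : recursive f -> recursive g -> recursive h ->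
  recursive (fun x => if f x is 0 then g x else h x).
Proof.
move=> rf rg rh.
(* A zero test is a recursion of length [f x] whose step forgets counter and previous value and
   returns [h] of the parameter. *)
have rh' := recursive_comp rh recursive_fst.
have rp := recursive_pair recursive_id rf.
apply: recursive_ext (recursive_comp (recursive_nat_rec rg rh') rp) => x.
by rewrite /= !pairE; case: (f x) => //= n; rewrite !pairE.
Qed.

(** Nested zero tests: each entry passed over lowers the selector [f x] by one. *)
Lemma recursive_switch (d f : nat -> nat) (gs : seq (nat -> nat)) :
  recursive d -> recursive f -> foldr (fun g P => recursive g /\ P) True gs ->
  recursive (fun x => nth d gs (f x) x).
Proof.
move=> rd; elim: gs f => [|g gs IHgs] f rf /=.
  by move=> _; apply: recursive_ext rd => x; rewrite nth_nil.
move=> [rg /(IHgs _ (recursive_comp recursive_pred rf)) rgs].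
by apply: recursive_ext (recursive_if0 rf rg rgs) => x /=; case: (f x).
Qed.

Ltac recursive_tac :=
  repeat match goal with
  | |- True => exact: I
  | |- _ /\ _ => split
  | |- recursive pfst => exact: recursive_fst
  | |- recursive psnd => exact: recursive_snd
  | |- recursive succn => exact: recursive_succ
  | |- recursive predn => exact: recursive_pred
  | |- recursive (fun x => x) => exact: recursive_id
  | |- recursive (fun x => ?c) => exact: (recursive_const c)
  | |- recursive (fun x => npair _ _) => apply: recursive_pair
  | |- recursive (fun x => pfst _) => apply: (recursive_comp recursive_fst)
  | |- recursive (fun x => psnd _) => apply: (recursive_comp recursive_snd)
  | |- recursive (fun x => (_).+1) => apply: (recursive_comp recursive_succ)
  | |- recursive (fun x => (_).-1) => apply: (recursive_comp recursive_pred)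
  | |- recursive (fun x => match _ with _ => _ end) => apply: recursive_if0
  end.

(** * A universal partial recursive function *)

(* A state is [<<<t, u>, K>, v>]: the task [<t, u>] is about to be applied to
   the current value [v], and [K] is the stack of the tasks to follow.  The tags
   [t < 8] are those of [encode]; 8 to 11 mark pending computations: 8 and 9
   the two halves of a [Pair], 10 a [Prec] with [u = <g, <a, <m, r>>>], where
   [m] steps are done and [r] remain, and 11 a [Mu] with [u = <f, <x, m>>],
   where [m] is being tried.  Any other tag means that the machine has stopped. *)
Definition state_tag (s : nat) : nat := pfst (pfst (pfst s)).
Definition state_arg (s : nat) : nat := psnd (pfst (pfst s)).
Definition state_stack (s : nat) : nat := psnd (pfst s).
Definition state_val (s : nat) : nat := psnd s.

Arguments state_tag : simpl never.
Arguments state_arg : simpl never.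
Arguments state_stack : simpl never.
Arguments state_val : simpl never.

Definition state (task K v : nat) : nat := npair (npair task K) v.

Lemma state_tagE t u K v : state_tag (state (npair t u) K v) = t.
Proof. by rewrite /state_tag !pairE. Qed.

Lemma state_argE t u K v : state_arg (state (npair t u) K v) = u.
Proof. by rewrite /state_arg !pairE. Qed.

Lemma state_stackE t K v : state_stack (state t K v) = K.
Proof. by rewrite /state_stack !pairE. Qed.

Lemma state_valE t K v : state_val (state t K v) = v.
Proof. by rewrite /state_val !pairE. Qed.

Definition stateE := (state_tagE, state_argE, state_stackE, state_valE).

Definition step_table : seq (nat -> nat) :=
  [:: (fun s => npair (state_stack s) 0);
      (fun s => npair (state_stack s) (state_val s).+1);
      (fun s => npair (state_stack s) (pfst (state_val s)));
      (fun s => npair (state_stack s) (psnd (state_val s)));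
      (fun s => state (pfst (state_arg s))
         (npair (npair 8 (npair (psnd (state_arg s)) (state_val s)))
            (state_stack s))
         (state_val s));
      (fun s => state (psnd (state_arg s))
         (npair (pfst (state_arg s)) (state_stack s))
         (state_val s));
      (fun s => state (pfst (state_arg s))
         (npair (npair 10 (npair (psnd (state_arg s))
            (npair (pfst (state_val s)) (npair 0 (psnd (state_val s))))))
            (state_stack s))
         (pfst (state_val s)));
      (fun s => state (state_arg s)
         (npair (npair 11 (npair (state_arg s) (npair (state_val s) 0)))
            (state_stack s))
         (npair (state_val s) 0));
      (fun s => state (pfst (state_arg s))
         (npair (npair 9 (state_val s)) (state_stack s))
         (psnd (state_arg s)));
      (fun s => npair (state_stack s) (npair (state_arg s) (state_val s)));
      (fun s => let u := state_arg s in
         let g := pfst u in let a := pfst (psnd u) in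
         let m := pfst (psnd (psnd u)) in let r := psnd (psnd (psnd u)) in
         if r is 0 then npair (state_stack s) (state_val s)
         else state g
           (npair (npair 10 (npair g (npair a (npair m.+1 r.-1))))
              (state_stack s))
           (npair a (npair m (state_val s))));
      (fun s => let u := state_arg s in
         let f := pfst u in let x := pfst (psnd u) in let m := psnd (psnd u) in
         if state_val s is 0 then npair (state_stack s) m
         else state f
           (npair (npair 11 (npair f (npair x m.+1))) (state_stack s))
           (npair x m.+1)) ].

Definition step (s : nat) : nat := nth id step_table (state_tag s) s.

Lemma recursive_step : recursive step.
Proof.
apply: recursive_switch; first exact: recursive_id.
  by rewrite /state_tag; recursive_tac.
rewrite /= /state /state_arg /state_stack /state_val.
by recursive_tac.
Qed.

Definition reaches (s s' : nat) : Prop := exists n, iter n step s = s'.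

Lemma reaches_trans s1 s2 s3 : reaches s1 s2 -> reaches s2 s3 -> reaches s1 s3.
Proof. by move=> [m <-] [n <-]; exists (n + m); rewrite iterD. Qed.

(** Popping a stack just pairs it with the new value, so the next state appears as bare [npair]s
    rather than as a [state]. *)
Lemma reaches_step task K v s :
  reaches (step (state task K v)) s -> reaches (npair (npair task K) v) s.
Proof. by apply: reaches_trans; exists 1. Qed.

Lemma step_state t u K v :
  step (state (npair t u) K v) = nth id step_table t (state (npair t u) K v).
Proof. by rewrite /step stateE. Qed.

Definition stepE := (step_state, stateE, pairE).

Ltac run_step :=
  apply: reaches_step; rewrite !stepE; cbv [nth step_table]; rewrite ?stepE /=.

(** Induction on [c] with the stack arbitrary, because subcomputations run above the tasks that [c]
    has pushed. *)
Lemma eval_reaches c x y K : eval c x y -> reaches (state (encode c) K x) (npair K y).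
Proof.
elim: c x y K => [||||f IHf g IHg|f IHf g IHg|f IHf g IHg|f IHf] x y K.
1-4: by move=> /= ->; run_step; exists 0.
- move=> /= [a [b [fa gb ->]]].
  run_step.
  apply: reaches_trans (IHf _ _ _ fa) _.
  run_step.
  apply: reaches_trans (IHg _ _ _ gb) _.
  by run_step; exists 0.
- move=> /= [z [gz fy]].
  run_step.
  by apply: reaches_trans (IHg _ _ _ gz) _; exact: IHf.
- rewrite /= -{2}(npairK x) /pfst /psnd.
  case: (Cantor.of_nat x) => a n /= an_y.
  run_step.
  (* Loop invariant: [r] steps done, [r'] remaining. Since the total is fixed, the induction on [r]
     uses its hypothesis at [r'.+1]. *)
  have loop r : forall z, prec_graph (eval f) (eval g) a r z ->
      forall r', reaches (state (encode f)
        (npair (npair 10 (npair (encode g) (npair a (npair 0 (r + r'))))) K) a)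
      (state (npair 10 (npair (encode g) (npair a (npair r r')))) K z).
    elim: r => [|r IHr] z /=; first by move=> fz r'; exact: IHf.
    move=> [w [rw gz]] r'; rewrite addSnnS.
    apply: reaches_trans (IHr _ rw _) _.
    run_step.
    exact: IHg.
  have := loop n _ an_y 0; rewrite addn0 => /reaches_trans; apply.
  by run_step; exists 0.
- move=> /= [f0 fS].
  run_step.
  (* The machine gets to trying candidate [m], as every smaller candidate has returned a
     successor. *)
  have loop m : m <= y -> reaches
      (state (encode f)
         (npair (npair 11 (npair (encode f) (npair x 0))) K) (npair x 0))
      (state (encode f)
         (npair (npair 11 (npair (encode f) (npair x m))) K) (npair x m)).
    elim: m => [|m IHm] lemy; first by exists 0.
    apply: reaches_trans (IHm (ltnW lemy)) _.
    have [k fk] := fS _ lemy.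
    apply: reaches_trans (IHf _ _ _ fk) _.
    by run_step; exists 0.
  apply: reaches_trans (loop _ (leqnn y)) _.
  apply: reaches_trans (IHf _ _ _ f0) _.
  by run_step; exists 0.
Qed.

Lemma step_halted s : 12 <= state_tag s -> step s = s.
Proof. by move=> ?; rewrite /step nth_default. Qed.

(** A normal form: build the initial state, search with one [Mu] for the least halting time, then
    read off the value. *)
Lemma universal_code : exists U, forall e x y, phi e x y -> eval U (npair e x) y.
Proof.
(* As initial stack, [halt] is popped last and exposes tag 12, the first index outside
   [step_table]. *)
pose halt := npair (npair 12 0) 0.
pose init z := state (pfst z) halt (psnd z).
pose run z := iter (psnd z) step (pfst z).
(* The default 0 signals a stopped machine, and [succn] gives the nonzero values that [Mu] requires
   before that. *)
pose test z := nth (fun=> 0) (nseq 12 succn) (state_tag (run z)) z.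
have rrun : recursive run by exact: recursive_iter recursive_step.
have [ci ciE] : recursive init by rewrite /init /state; recursive_tac.
have [cv cvE] : recursive (fun z => state_val (run z)).
  exact: recursive_comp recursive_snd rrun.
have [ct ctE] : recursive test.
  apply: recursive_switch; [exact: recursive_const | | by rewrite /=; recursive_tac].
  by apply: recursive_comp rrun; rewrite /state_tag; recursive_tac.
have testE z : (test z == 0) = (12 <= state_tag (run z)).
  rewrite /test; have [t12|t12] := leqP 12 (state_tag (run z)).
    by rewrite nth_default.
  by rewrite nth_nseq t12.
exists (Comp cv (Pair ci (Comp (Mu ct) ci))) => e x y [c [<- cxy]].
have [n runn] := eval_reaches halt cxy; set s := state (encode c) halt x in runn.
have initE : init (npair (encode c) x) = s by rewrite /init !pairE.
have halted : exists k, test (npair s k) == 0.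
  by exists n; rewrite testE /run !pairE runn /state_tag !pairE.
have [m m0 mmin] := ex_minnP halted.
have lemn : m <= n.
  by apply: mmin; rewrite testE /run !pairE runn /state_tag !pairE.
(* A halted state is fixed by [step], so the states at times [m] and [n] agree. *)
have runm : run (npair s m) = npair halt y.
  rewrite -runn -(subnK lemn) iterD /run !pairE.
  elim: (n - m) => //= k <-; rewrite step_halted //.
  by move: m0; rewrite testE /run !pairE.
exists (npair s m); split; last first.
  by have := cvE (npair s m); rewrite runm /state_val pairE.
exists s, m; split=> //; first by rewrite -initE; exact: ciE.
exists s; split; first by rewrite -initE; exact: ciE.
split=> [|k ltkm]; first by rewrite -(eqP m0); exact: ctE.
have : test (npair s k) != 0.
  by apply/negP => /mmin; rewrite leqNgt ltkm.
by rewrite -lt0n => /prednK kE; exists (test (npair s k)).-1; rewrite kE; exact: ctE.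
Qed.

(** * Realizers *)

Lemma phi_encode c x y : phi (encode c) x y <-> eval c x y.
Proof. by split=> [[d [/encode_inj-> //]]|cxy]; exists c. Qed.

Lemma apply_at_code a : exists c, forall e y, phi e a y -> eval c e y.
Proof.
have [U UP] := universal_code.
exists (Comp U (Pair id_code (const_code a))) => e y eay.
exists (npair e a); split; last exact: UP.
by exists e, a; split=> //; [exact: id_codeE | exact: const_codeE].
Qed.

(** The ingredient of the s-m-n theorem used below: the index for [n] arises by iterating the
    encoding of a composition with [Succ]. *)
Lemma recursive_encode_const : recursive (fun n => encode (const_code n)).
Proof.
pose f z := npair 5 (npair (encode Succ) z).
have rf : recursive f.
  do 2 (apply: recursive_pair; first exact: recursive_const).
  exact: recursive_id.
have rp := recursive_pair (recursive_const (encode Zero)) recursive_id.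
apply: recursive_ext (recursive_comp (recursive_iter rf) rp) => n.
by rewrite /= !pairE; elim: n => //= n ->.
Qed.

(** A realizer sends [a] to an index, namely [encode (c a)], of the evaluation [<s, t> |-> t a]. *)
Lemma id_rle_lo theta : (id ≼ lo theta)%rz.
Proof.
have [U UP] := universal_code.
pose c a := Comp U (Pair Snd (const_code a)).
have [d dE] : recursive (fun a => encode (c a)).
  rewrite /c /=; do 4 (apply: recursive_pair; first exact: recursive_const).
  exact: recursive_encode_const.
exists (encode d) => p _ a pa; exists (encode (c a)).
split; first by apply/phi_encode; exact: dE.
move=> q _ _ [s [t [_ tpq ->]]]; have [b [tab qb]] := tpq _ pa.
exists b; split=> //; apply/phi_encode; exists (npair t a); split; last exact: UP.
exists t, a; split=> //; last exact: const_codeE.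
by rewrite /= -/(psnd _) pairE.
Qed.

(** Take [q := p] in [lo]: the map [<n, e> |-> e a] realizes [mo p ⇒ p], the identity realizes
    [p ⇒ p], and the realizer sought feeds their pair to its argument. *)
Lemma lo_coll_rle_id (A : set (set nat)) a :
  (forall B, A B -> B a) -> (lo_coll A ≼ id)%rz.
Proof.
move=> Aa.
have [c cP] := apply_at_code a.
have [d dP] : exists d, forall n e y, phi e a y -> eval d (npair n e) y.
  exists (Comp c Snd) => n e y /cP ?; exists e; split=> //=.
  by rewrite -/(psnd _) pairE.
have [r rP] := apply_at_code (npair (encode d) (encode id_code)).
exists (encode r) => p _ x xp.
have [|b [xb pb]] := xp p I (npair (encode d) (encode id_code)).
- exists (encode d), (encode id_code); split=> //.
  + move=> _ [n [e [-> [B AB eBp]]]].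
    have [y [eay py]] := eBp _ (Aa _ AB).
    by exists y; split=> //; apply/phi_encode; exact: dP.
  + by move=> y py; exists y; split=> //; apply/phi_encode; exact: id_codeE.
- by exists b; split=> //; apply/phi_encode; exact: rP.
Qed.

Lemma lo_Oomega_common : exists e, forall n, lo_coll Oomega (~` [set n]) e.
Proof.
have [U UP] := universal_code.
(* The index is uniform in [n]: an element of [mo] does not record which member of [Oomega]
   witnesses it. *)
exists (encode (Comp U (Pair Fst (Pair Zero Snd)))) => n q _ _ [s [t [sq tq ->]]].
have [|b [sb qb]] := sq (npair 0 t).
  by exists 0, t; split=> //; exists (~` [set n]) => //; exists n.
exists b; split=> //; apply/phi_encode; exists (npair s (npair 0 t)).
split; last exact: UP.
exists s, (npair 0 t); split=> //; first by rewrite /= -/(pfst _) pairE.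
by exists 0, t; split=> //=; rewrite -/(psnd _) pairE.
Qed.

Lemma lo_Oomega_not_rle_id : ~ (lo_coll Oomega ≼ id)%rz.
Proof.
move=> [r rP]; have [e eP] := lo_Oomega_common.
have [b [reb _]] := rP _ I _ (eP 0).
(* Diagonal choice: [n] is the value [b] of [r] at [e] itself. *)
have [b' [reb' b'b]] := rP _ I _ (eP b).
by apply: b'b; rewrite (phi_functional reb reb').
Qed.

(** [mo] stands to the left of two nested implications in [lo], hence positively, and the same
    number serves on both sides. *)
Lemma mo_subset_lo theta theta' p :
  (forall q, mo theta q `<=` mo theta' q) -> lo theta p `<=` lo theta' p.
Proof.
move=> sub e ep q _ _ [s [t [sq tq ->]]].
by apply: ep => //; exists s, t; split=> // x /sub; exact: sq.
Qed.

Lemma mo_Oomega_subset (A : set (set nat)) q :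
  (forall n, exists2 B, A B & ~ B n) -> mo (fun=> Oomega) q `<=` mo (fun=> A) q.
Proof.
move=> An _ [k [e [-> [_ [n _ <-] eq]]]]; exists k, e; split=> //.
have [B AB nBn] := An n; exists B => // b Bb.
by apply: eq => bn; apply: nBn; rewrite -bn.
Qed.

Theorem proposition3p5p16 :
  (id ≺ lo_coll Oomega)%rz /\
  (forall A : set (set nat),
     (id ≺ lo_coll A)%rz -> (lo_coll Oomega ≼ lo_coll A)%rz).
Proof.
split; first by split; [exact: id_rle_lo | exact: lo_Oomega_not_rle_id].
move=> A [_ nle].
have An n : exists2 B, A B & ~ B n.
  apply: contrapT => noB; apply: nle; apply: (@lo_coll_rle_id _ n) => B AB.
  by apply: contrapT => nBn; apply: noB; exists B.
exists (encode id_code) => p _ e ep; exists e.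
split; first by apply/phi_encode; exact: id_codeE.
by apply: mo_subset_lo ep => q; exact: mo_Oomega_subset.
Qed.
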